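(* Let $p$ be a prime, $q=p^n$ with $n\ge 1$, let $m>1$ be an integer, and let $k$ and $l$ be positive integers with $l\le k$. Let $\gamma_1,\dots,\gamma_k\in\mathbf{F}_{q^m}$ be linearly independent over $\mathbf{F}_q$, let $f_1,\dots,f_k:\mathbf{F}_{q^m}\to\mathbf{F}_q$ be functions, and let $b_{ij}\in\mathbf{F}_q$ ($1\le i,j\le k$) be such that $\gamma_i$ is a $b_{ij}$-linear translator of $f_j$ for all $1\le i,j\le k$. Let $A=(b_{ij})_{1\le i,j\le k}$ be the resulting $k\times k$ matrix over $\mathbf{F}_q$ and let $I$ be the $k\times k$ identity matrix over $\mathbf{F}_q$. Put $F(x):=x+\sum_{j=1}^k\gamma_j f_j(x)$. Then each of the following is true: (1) $F(x)$ is a permutation polynomial of $\mathbf{F}_{q^m}$ if and only if $\mathrm{rank}(I+A)=k$. (2) $F(x)$ is a $q^l$-to-$1$ mapping of $\mathbf{F}_{q^m}$ if $\mathrm{rank}(I+A)=k-l$.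
   Context: $\mathbf{F}_{r}$ denotes the finite field with $r$ elements. A polynomial (or map) is a permutation polynomial of a finite field if it induces a bijection of that field onto itself; maps on finite fields are identified with polynomials. A mapping $F$ of $\mathbf{F}_{q^m}$ to itself is $q^l$-to-$1$ if every element of the image of $F$ has exactly $q^l$ preimages. Linear translator: let $f:\mathbf{F}_{q^m}\to\mathbf{F}_q$, $a\in\mathbf{F}_q$ and let $\alpha$ be a nonzero element of $\mathbf{F}_{q^m}$. One says $\alpha$ is an $a$-linear translator of $f$ if $f(x+u\alpha)-f(x)=ua$ for all $x\in\mathbf{F}_{q^m}$ and all $u\in\mathbf{F}_q$. *)

(* Defs.v *)
From HB Require Import structures.
From mathcomp Require Import all_boot all_order all_algebra all_field.

Set Implicit Arguments.
Unset Strict Implicit.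
Unset Printing Implicit Defensive.

Import GRing.Theory.
Local Open Scope ring_scope.

Definition linear_translator (F : finFieldType) (L : fieldExtType F)
    (f : L -> F) (a : F) (alpha : L) : Prop :=
  alpha != 0 /\ forall (x : L) (u : F), f (x + u *: alpha) - f x = u * a.

(* Maps of a finite field to itself are identified with polynomials. *)
Definition permutation_map (T : finFieldType) (G : T -> T) : Prop :=
  bijective G.

Definition to_one_map (T : finFieldType) (N : nat) (G : T -> T) : Prop :=
  forall y : T, y \in codom G -> #|[set x : T | G x == y]| = N.

(* The map x |-> x + \sum_j gamma_j f_j(x).  The coefficient f_j(x) of F is
   embedded in the extension field L by the scaling f_j(x) *: gamma_j. *)
Definition translator_map (F : finFieldType) (L : fieldExtType F) (k : nat)
    (gamma : k.-tuple L) (f : 'I_k -> L -> F) (x : L) : L :=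
  x + \sum_(j < k) f j x *: tnth gamma j.

(* Main.v *)
(** Put phi c = \sum_i c_i gamma_i.  The translator property gives
    G (x + phi c) = G x + phi (c (I + A)), and G x = G y forces x - y into the
    range of the injective map phi.  So each nonempty fiber of G is a translate
    of the image under phi of the left kernel of I + A, and has
    q ^ (k - rank (I + A)) elements. *)
Require Import Defs.
From HB Require Import structures.
From mathcomp Require Import all_boot all_order all_algebra all_field.
From mathcomp Require Import mxabelem.

Set Implicit Arguments.
Unset Strict Implicit.
Unset Printing Implicit Defensive.

Import GRing.Theory.
Local Open Scope ring_scope.

Section TranslatorMap.

Variables (F : finFieldType) (L : fieldExtType F) (k : nat).
Variables (gamma : k.-tuple L) (f : 'I_k -> L -> F) (A : 'M[F]_k).
Hypothesis gamma_free : free gamma.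
Hypothesis translators : forall i j : 'I_k,
  linear_translator (f j) (A i j) (tnth gamma i).

(** Coordinates are kept as a row vector, so that [1%:M + A] acts on the right and its left kernel
    [kermx] is the relevant one. *)
Definition lincomb (c : 'rV[F]_k) : L := \sum_i c 0 i *: tnth gamma i.

Fact lincomb_is_zmod_morphism : zmod_morphism lincomb.
Proof.
by move=> c d; rewrite -sumrB; apply: eq_bigr => i _; rewrite !mxE scalerBl.
Qed.

HB.instance Definition _ :=
  GRing.isZmodMorphism.Build 'rV[F]_k L lincomb lincomb_is_zmod_morphism.

Lemma lincomb_inj : injective lincomb.
Proof.
apply: raddf_inj => c c0; apply/rowP => i; rewrite mxE.
have /freeP/(_ (c 0)) := gamma_free.
by under eq_bigr => j _ do rewrite -tnth_nth; apply.
Qed.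

(** Shifts along the [tnth gamma i] are made one at a time, each adding [c 0 i * A i j]. An
    arbitrary list of indices and a general [x] let the induction absorb each shift into the base
    point. *)
Lemma translator_sum (r : seq 'I_k) (c : 'rV[F]_k) x j :
  f j (x + \sum_(i <- r) c 0 i *: tnth gamma i)
  = f j x + \sum_(i <- r) c 0 i * A i j.
Proof.
elim: r x => [|i r IHr] x; first by rewrite !big_nil !addr0.
rewrite !big_cons addrA IHr addrA; congr (_ + _).
by have [_ /(_ x (c 0 i)) <-] := translators i j; rewrite [RHS]addrC subrK.
Qed.

Lemma translator_mapE x :
  translator_map gamma f x = x + lincomb (\row_j f j x).
Proof. by congr (_ + _); apply: eq_bigr => j _; rewrite mxE. Qed.

Lemma translator_map_lincomb x c :
  translator_map gamma f (x + lincomb c)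
  = translator_map gamma f x + lincomb (c *m (1%:M + A)).
Proof.
(* The increment of the row of values [f j] under the shift by [lincomb c] is exactly [c *m A]. *)
have -> : c *m (1%:M + A) = c + (\row_j f j (x + lincomb c) - \row_j f j x).
  rewrite mulmxDr mulmx1; congr (_ + _); apply/rowP => j.
  by rewrite !mxE translator_sum addrC addKr.
rewrite !translator_mapE raddfD raddfB /= addrACA; congr (_ + _).
by rewrite addrC subrK.
Qed.

Lemma translator_map_fiber x y :
  translator_map gamma f x = translator_map gamma f y <->
  exists2 c, (c <= kermx (1%:M + A)%R)%MS & x = y + lincomb c.
Proof.
split=> [eqG | [c /sub_kermxP c0 ->]]; last first.
  by rewrite translator_map_lincomb c0 raddf0 addr0.
(* Solving [x + lincomb (f x) = y + lincomb (f y)] for [x] yields the witness. *)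
have def_x : x = y + lincomb (\row_j f j y - \row_j f j x).
  by move: eqG; rewrite !translator_mapE raddfB addrA => <-; rewrite addrK.
exists (\row_j f j y - \row_j f j x) => //; apply/sub_kermxP/lincomb_inj.
(* Adding the image of [y] turns the goal into the assumed equality of the images of [x] and [y]. *)
apply: (addrI (translator_map gamma f y)).
by rewrite -translator_map_lincomb -def_x raddf0 addr0.
Qed.

(** The left kernel has dimension [k - \rank (1%:M + A)], and [c |-> y + lincomb c] maps it
    bijectively onto the fiber through [y]. The type [finvect_type L] is [L] with its finite
    structure, needed for counting. *)
Lemma card_translator_map_fiber (y : L) :
  #|[set x : finvect_type L | translator_map gamma f x
                              == translator_map gamma f y]|
  = (#|F| ^ (k - \rank (1%:M + A)%R))%N.
Proof.
rewrite -mxrank_ker -card_rowg.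
have inj_shift : injective (fun c => y + lincomb c : finvect_type L).
  by move=> c d /addrI/lincomb_inj.
rewrite -(card_imset _ inj_shift); apply: eq_card => x; rewrite inE.
apply/eqP/imsetP => [/translator_map_fiber[c] | [c]].
  by rewrite -mem_rowg => kc ->; exists c.
by rewrite mem_rowg => kc ->; apply/translator_map_fiber; exists c.
Qed.

End TranslatorMap.

Theorem theorem2p2 (p n q m k l : nat)
    (p_prime : prime p) (n_ge1 : (1 <= n)%N) (q_def : q = (p ^ n)%N)
    (m_gt1 : (1 < m)%N)
    (k_gt0 : (0 < k)%N) (l_gt0 : (0 < l)%N) (l_le_k : (l <= k)%N)
    (F : finFieldType) (card_F : #|F| = q)
    (L : fieldExtType F) (dim_L : \dim {:L} = m)
    (gamma : k.-tuple L) (gamma_free : free gamma)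
    (f : 'I_k -> L -> F) (A : 'M[F]_k)
    (translators : forall i j : 'I_k,
       linear_translator (f j) (A i j) (tnth gamma i)) :
  (@permutation_map (finvect_type L) (translator_map gamma f)
     <-> \rank (1%:M + A)%R = k)
  /\ (\rank (1%:M + A)%R = (k - l)%N ->
      @to_one_map (finvect_type L) (q ^ l)%N (translator_map gamma f)).
Proof.
have card_fiber := card_translator_map_fiber gamma_free translators.
split; last first.
  move=> rkA y /codomP[x ->].
  (* The truncated difference [k - (k - l)] equals [l] because [l <= k]. *)
  by rewrite card_fiber card_F rkA subKn.
split=> [/bij_inj injG | rkA].
  (* By injectivity the fiber through [0] is a singleton, so [#|F| ^ (k - \rank (1%:M + A)) = 1]; as
     [#|F| > 1], the exponent vanishes. *)
  have := card_fiber 0; rewrite (_ : [set _ | _] = [set 0]); last first.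
    by apply/setP => x; rewrite !inE (inj_eq injG).
  move/esym/eqP; rewrite cards1 -(expn0 #|F|) eqn_exp2l ?finNzRing_gt1 //.
  rewrite subn_eq0 => le_k_rk.
  by apply/eqP; rewrite eqn_leq rank_leq_row.
(* On a finite type injectivity suffices; full rank makes the fiber through [y] a singleton, and it
   contains both [x] and [y]. *)
apply: injF_bij => x y eqG.
have /eqP/cards1P[z fiber_y] : #|[set x : finvect_type L |
    translator_map gamma f x == translator_map gamma f y]| = 1%N.
  by rewrite card_fiber rkA subnn.
have: x \in [set z] by rewrite -fiber_y inE eqG.
have: y \in [set z] by rewrite -fiber_y inE.
by move=> /set1P-> /set1P->.
Qed.
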